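(* Let $F:\mathbb{N}^+\times\mathbb{N}^+\to\mathbb{N}^+$ be defined by $$F(m,n)=\frac{1}{4}\left[(m+n-1)^2-\big((m+n-1)\bmod 2\big)\right]+\min(m,n).$$ Let $S_O=\{(x,y)\in\mathbb{N}^+\times\mathbb{N}^+ : x\ge y\}$. Then the restriction of $F$ to $S_O$ is a surjection from $S_O$ onto $\mathbb{N}^+$.
   Context: $\mathbb{N}^+$ denotes the set of positive integers. For an integer $k$, $k\bmod 2$ denotes the least non-negative residue of $k$ modulo $2$. *)

(* Defs.v *)
From mathcomp Require Import all_boot all_order all_algebra.
From mathcomp Require Import zify ring lra.
From mathcomp Require Import boolp classical_sets functions.

Set Implicit Arguments.
Unset Strict Implicit.
Unset Printing Implicit Defensive.

Import Order.TTheory GRing.Theory Num.Theory.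

Definition posnat : Type := {n : nat | 0 < n}.

(* Subtraction and division in [nat] are exact here: m + n >= 1, and
   k ^ 2 - k %% 2 is a multiple of 4 for every k; see [FE] below. *)
Definition Fnat (m n : nat) : nat :=
  ((m + n - 1) ^ 2 - (m + n - 1) %% 2) %/ 4 + minn m n.

Lemma Fnat_gt0 (p : posnat * posnat) : 0 < Fnat (val p.1) (val p.2).
Proof. by rewrite addn_gt0 leq_min (valP p.1) (valP p.2) orbT. Qed.

Definition F (p : posnat * posnat) : posnat :=
  exist _ (Fnat (val p.1) (val p.2)) (Fnat_gt0 p).

Definition S_O : set (posnat * posnat) := [set p | val p.2 <= val p.1]%classic.

Lemma sqr_sub_mod2 (k : nat) :
  ((k ^ 2 - k %% 2) %/ 4 * 4 + k %% 2 = k ^ 2)%N.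
Proof.
have := divn_eq k 2; have := ltn_pmod k (isT : 0 < 2).
case: (k %% 2) => [|[|//]] _ ->; set q := k %/ 2.
- have -> : (q * 2 + 0) ^ 2 = q ^ 2 * 4 by rewrite addn0 expnMn.
  by rewrite subn0 mulnK ?addn0.
- have -> : (q * 2 + 1) ^ 2 = (q ^ 2 + q) * 4 + 1 by ring.
  by rewrite addnK mulnK.
Qed.

Lemma FE (m n : posnat) :
  let k : int := ((val m)%:Z + (val n)%:Z - 1)%R in
  ((val (F (m, n)))%:R =
   1 / 4 * ((k ^+ 2)%:~R - (k %% 2)%Z%:~R) + (minn (val m) (val n))%:R :> rat)%R.
Proof.
case: m n => [m m0] [n n0] /=.
have -> : (m%:Z + n%:Z - 1)%R = Posz (m + n - 1) by lia.
set k := (m + n - 1)%N.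
rewrite modz_nat /Fnat -/k natrD; congr (_ + _)%R.
have /(congr1 (fun i : nat => i%:R%R : rat)) := sqr_sub_mod2 k.
rewrite natrD natrM natrX => H.
by rewrite rmorphXn /= !pmulrn -!pmulrn -H; field.
Qed.

(* Main.v *)
Require Import Defs.
From mathcomp Require Import all_boot all_order all_algebra.
From mathcomp Require Import zify.
From mathcomp Require Import boolp classical_sets functions.

(** On each antidiagonal [x + y = c], moving from [(x, y)] to [(x - 1, y + 1)]
    increases [F] by one as long as the point stays in [x >= y]; and the last such
    point of the antidiagonal is followed, in the order of values of [F], by the
    first point [(c, 1)] of the next one.  Hence the values of [F] on [S_O]
    contain [1] and are closed under successor. *)

(** The quadratic term depends only on [x + y], and the minimum goes from [y] to [y.+1]. *)
Lemma Fnat_step_antidiagonal (x y : nat) :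
  y.+2 <= x -> Fnat x.-1 y.+1 = (Fnat x y).+1.
Proof.
move=> yx; rewrite /Fnat; have -> : x.-1 + y.+1 = x + y by lia.
by rewrite -addnS; congr (_ + _); lia.
Qed.

(** The quotient is the floor of [k ^ 2 / 4]. *)
Lemma quarter_sqrS (k : nat) :
  (k.+1 ^ 2 - k.+1 %% 2) %/ 4 = (k ^ 2 - k %% 2) %/ 4 + k.+1 %/ 2.
Proof.
have := sqr_sub_mod2 k.+1; have := sqr_sub_mod2 k.
have -> : k.+1 ^ 2 = k ^ 2 + k * 2 + 1 by rewrite -addn1 sqrnD muln1; lia.
(* With the square abstracted, what remains is linear. *)
by move: (k ^ 2) => s; lia.
Qed.

(** Here [y] is both [minn x y] and [(x + y) %/ 2]: the quadratic term gains [y], while the minimum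
    drops from [y] to [1]. *)
Lemma Fnat_step_next_antidiagonal (x y : nat) :
  0 < y -> y <= x <= y.+1 -> Fnat (x + y) 1 = (Fnat x y).+1.
Proof.
move=> y0 /andP[yx xy]; rewrite /Fnat addnK.
have {1 2}-> : x + y = (x + y - 1).+1 by lia.
by rewrite quarter_sqrS; lia.
Qed.

Lemma Fnat_surj (k : nat) :
  exists x y, [/\ 0 < y, y <= x & Fnat x y = k.+1].
Proof.
elim: k => [|k [x [y [y0 yx Fxy]]]]; first by exists 1, 1.
have [xy|xy] := leqP y.+2 x.
- by exists x.-1, y.+1; split; [|lia|rewrite Fnat_step_antidiagonal ?Fxy].
- exists (x + y), 1; split=> //; first lia.
  by rewrite Fnat_step_next_antidiagonal ?Fxy // yx -ltnS.
Qed.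

Theorem theorem2 : set_surj S_O [set: posnat]%classic F.
Proof.
move=> [[//|k] k0] _.
have [x [y [y0 yx Fxy]]] := Fnat_surj k.
exists (exist _ x (leq_trans y0 yx), exist _ y y0) => //.
exact: val_inj.
Qed.
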